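(* Let $\mu$ be a unimodular probability measure on $\mathcal G_\ast$ such that $\deg_G(o)>0$ for $\mu$-a.e. $[G,o]$ and such that, for some $D\in\mathbb N$, $\deg_G(v)\le D$ for all $v\in V(G)$ for $\mu$-a.e. $[G,o]$. Let $H=K=\mathbb R$, let $\eta\in L^2(\mu,\mathbb R)$, and put $f([G,o],a)=-\eta([G,o])\,a$, $h([G,o,v],a,b)=\frac12(a-b)^2$ and $\psi=h$. Then $(f,h,\psi)$ is an admissible potential triple for $\mu$ (as defined in the context), and for $\mu$-a.e. $[G,o]$ and every family $(b_v)_{v\sim o}\subset\mathbb R$ the map $a\mapsto f([G,o],a)+\sum_{v\sim o}h([G,o,v],a,b_v)$ is convex. The corresponding potential functional is $$\Phi(x)=\int_{\mathcal G_\ast}\bigg[-\eta([G,o])\,x([G,o])+\frac14\sum_{v\sim o}\big(x([G,o])-x([G,v])\big)^2\bigg]\mu(d[G,o]),\qquad x\in\mathcal H=L^2(\mu,\mathbb R).$$ Consequently, if $x^\ast\in\mathcal H$ satisfies $$(\Delta x^\ast)([G,o])=\frac{\eta([G,o])}{\deg_G(o)}\quad\text{for }\mu\text{-a.e. }[G,o],$$ where $(\Delta x)([G,o])=x([G,o])-\frac1{\deg_G(o)}\sum_{v\sim o}x([G,v])$, then $x^\ast$ is a quenched Nash equilibrium.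
   Context: Graphs. All graphs $G=(V,E)$ are simple (undirected, no loops or multiple edges), locally finite, with finite or countably infinite vertex set $V=V(G)$; $u\sim v$ means $\{u,v\}\in E$. A rooted graph $(G,o)$ is a graph with a distinguished vertex $o$; rooted isomorphisms are graph isomorphisms mapping root to root, and $[G,o]$ is the isomorphism class. $B_r(G,o)$ is the rooted subgraph induced by the vertices at graph distance at most $r$ from $o$. $\mathcal G_\ast$ is the set of isomorphism classes of countable, connected, rooted graphs with metric $d_\ast([G,o],[G',o'])=\inf_{r\in\mathbb N_0}\{2^{-r}:B_r(G,o)\cong B_r(G',o')\}$. $\mathcal G_{\ast\ast}$ is the analogous space of isomorphism classes $[G,o_1,o_2]$ of countable, connected, doubly rooted graphs (isomorphisms preserve both roots in order), with the analogous metric $d_{\ast\ast}$. Both carry Borel $\sigma$-fields. A probability measure $\mu$ on $\mathcal G_\ast$ is unimodular if for every measurable $T:\mathcal G_{\ast\ast}\to[0,\infty]$, $\int\sum_{v\in V(G)}T([G,o,v])\,\mu(d[G,o])=\int\sum_{v\in V(G)}T([G,v,o])\,\mu(d[G,o])$. Spaces. $H$ is a separable real Hilbert space and $K\subset H$ is nonempty, closed and convex (in this statement $H=K=\mathbb R$). $\mathcal H=L^2(\mu,H)$ is the space of measurable $x:\mathcal G_\ast\to H$ with $\int\|x([G,o])\|_H^2\,\mu(d[G,o])<\infty$, and $\mathcal K=\{x\in\mathcal H:x([G,o])\in K\text{ for }\mu\text{-a.e. }[G,o]\}$ (here $\mathcal K=\mathcal H$). For $x:\mathcal G_\ast\to H$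 and a countable connected graph $G$, write $x^G_v=x([G,v])$, $v\in V(G)$, and $x^G=(x^G_v)_{v\in V(G)}$. Admissible potential triple. Measurable functions $f:\mathcal G_\ast\times H\to\mathbb R$, $h:\mathcal G_{\ast\ast}\times H\times H\to\mathbb R$ and $\psi:\mathcal G_{\ast\ast}\times H\times H\to\mathbb R$ form an admissible potential triple for $\mu$ if the following hold ($\nabla$ is the Gâteaux gradient; $\nabla_1,\nabla_2$ are partial gradients in the first and second $H$-argument). (i) For $\mu$-a.e. $[G,o]$, $a\mapsto f([G,o],a)$ is Gâteaux differentiable on $H$. (ii) For $\mu$-a.e. $[G,o]$ and every $v\sim o$: $a\mapsto h([G,o,v],a,b)$ is Gâteaux differentiable on $H$ for every $b\in H$; $(a,b)\mapsto\psi([G,o,v],a,b)$ is Gâteaux differentiable on $H\times H$; and for all $a,b\in H$, $\nabla_1\psi([G,o,v],a,b)=\nabla_1h([G,o,v],a,b)$ and $\nabla_2\psi([G,o,v],a,b)=\nabla_1h([G,v,o],b,a)$. (iii) There are constants $L_f,L_h\ge0$ such that for $\mu$-a.e. $[G,o]$, every $v\sim o$ and all $a,a',b,b'\in H$: $\|\nabla f([G,o],a)-\nabla f([G,o],a')\|_H\le L_f\|a-a'\|_H$ and $\|\nabla_1h([G,o,v],a,b)-\nabla_1h([G,o,v],a',b')\|_H\le L_h(\|a-a'\|_H+\|b-b'\|_H)$. (iv) There is $a_\ast\in H$ such that the functions $|f([G,o],a_\ast)|$, $\|\nabla f([G,o],a_\ast)\|_H^2$, $\sum_{v\sim o}|\psi([G,o,v],a_\ast,a_\ast)|$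 and $\sum_{v\sim o}\|\nabla_1h([G,o,v],a_\ast,a_\ast)\|_H^2$ of $[G,o]$ all have finite $\mu$-integral. Potential functional. In general $\Phi(x)=\int_{\mathcal G_\ast}\big[f([G,o],x([G,o]))+\frac12\sum_{v\sim o}\psi([G,o,v],x([G,o]),x([G,v]))\big]\mu(d[G,o])$ for $x\in\mathcal H$. Game. The cost of player $v\in V(G)$ under an action profile $x^G\in K^{V(G)}$ is $J^G_v(x^G)=f([G,v],x^G_v)+\sum_{u\sim v}h([G,v,u],x^G_v,x^G_u)$. An element $x\in\mathcal K$ is a quenched Nash equilibrium if for $\mu$-a.e. $[G,o]$, $J^G_o(x^G)\le J^G_o(a,x^G_{-o})$ for all $a\in K$, where $(a,x^G_{-o})$ is $x^G$ with the root action $x^G_o$ replaced by $a$. *)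

(* Defs.v *)
From HB Require Import structures.
From mathcomp Require Import all_boot all_order all_algebra finmap.
From mathcomp Require Import generic_quotient.
From mathcomp Require Import all_classical all_reals all_analysis.
From mathcomp Require Import measurable_realfun.

Set Implicit Arguments.
Unset Strict Implicit.
Unset Printing Implicit Defensive.

Import Order.TTheory GRing.Theory Num.Theory.
Import numFieldNormedType.Exports.

Local Open Scope classical_set_scope.
Local Open Scope ring_scope.

(* Simple connected locally finite graphs, with a set of natural numbers as
   vertices. Every countable connected graph of the theory is isomorphic to one
   of these. *)
Record graph : Set := Graph {
  vset : nat -> bool;
  vertex := {n : nat | vset n};
  adj : vertex -> vertex -> bool;
  adj_sym : symmetric adj;
  adj_irr : irreflexive adj;
  adj_connected :
    forall u v : vertex, exists p : seq vertex, path adj u p /\ last u p = v;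
  adj_locally_finite : forall v : vertex, finite_set [set u | adj v u]
}.
Coercion vertex : graph >-> Sortclass.

Definition nbrs (G : graph) (v : G) : set G := [set u | adj v u].

Definition deg (G : graph) (v : G) : nat := #|` fset_set (nbrs v)|%fset.

(* A graph with k.+1 ordered roots, repetitions allowed; only k = 0 (rooted)
   and k = 1 (doubly rooted) are used. *)
Record mgraph (k : nat) := MGraph { mg :> graph; roots : k.+1.-tuple mg }.

HB.instance Definition _ k := gen_eqMixin (mgraph k).
HB.instance Definition _ k := gen_choiceMixin (mgraph k).

(* The vertices at graph distance at most r from some root. *)
Definition rball k (g : mgraph k) (r : nat) : set g :=
  [set v | exists o (p : seq g), [/\ o \in tval (roots g), path (@adj g) o p,
                                     last o p = v & (size p <= r)%N]].

Arguments rball {k} g r _.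

(* f restricts to an isomorphism between the induced subgraphs on A and A',
   and it maps the roots to the roots. Its values outside A are irrelevant. *)
Definition is_iso k (g g' : mgraph k) (A : set g) (A' : set g') (f : g -> g') :=
  [/\ set_bij A A' f,
      forall u v, A u -> A v -> adj (f u) (f v) = adj u v &
      map f (roots g) = tval (roots g')].

Definition iso k (g g' : mgraph k) := exists f, is_iso [set: g] [set: g'] f.

Definition ball_iso k (r : nat) (g g' : mgraph k) :=
  exists f, is_iso (rball g r) (rball g' r) f.

Lemma root_rball k (g : mgraph k) r o : o \in tval (roots g) -> rball g r o.
Proof. by move=> go; exists o, [::]. Qed.

Lemma is_iso_id k (g : mgraph k) (A : set g) : is_iso A A id.
Proof.
split => //; last by rewrite map_id.
by split => //= x; exists x.
Qed.

Lemma is_iso_comp k (g g' g'' : mgraph k) (A : set g) (A' : set g')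
    (A'' : set g'') f f' :
  is_iso A A' f -> is_iso A' A'' f' -> is_iso A A'' (f' \o f).
Proof.
move=> [bf af rf] [bf' af' rf']; split.
- case: bf => f1 f2 f3; case: bf' => f1' f2' f3'; split.
  + by move=> x /f1 /f1'.
  + move=> x y; rewrite !inE => Ax Ay /= e.
    by apply: f2; rewrite ?inE//; apply: f2'; rewrite ?inE//; exact: f1.
  + by move=> z /f3' [y /f3 [x Ax <-] <-]; exists x.
- move=> u v Au Av /=; case: bf => f1 _ _.
  by rewrite af' ?af//; exact: f1.
- by rewrite map_comp rf.
Qed.

Lemma is_iso_inv k (g g' : mgraph k) (A : set g) (A' : set g') f :
  (forall o, o \in tval (roots g) -> A o) -> is_iso A A' f ->
  exists2 f', is_iso A' A f' &
    (forall x, A x -> f' (f x) = x) /\ (forall y, A' y -> f (f' y) = y).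
Proof.
move=> Aroots [[f1 f2 f3] af rf].
have /choice[f' f'P] y : exists x, A' y -> A x /\ f x = y.
  have [A'y|] := pselect (A' y); last by exists (thead (roots g)).
  by have [x Ax <-] := f3 _ A'y; exists x.
have f'K x : A x -> f' (f x) = x.
  move=> Ax; have [A1 e] := f'P _ (f1 _ Ax).
  by apply: f2; rewrite ?inE.
exists f'; last by split=> // y /f'P[].
split.
- split.
  + by move=> y /f'P[].
  + move=> y z; rewrite !inE => /f'P[_ ey] /f'P[_ ez] e.
    by rewrite -ey -ez e.
  + by move=> x Ax; exists (f x); [exact: f1|exact: f'K].
- move=> u v /f'P[Au eu] /f'P[Av ev].
  by rewrite -af// eu ev.
- rewrite -rf -map_comp -[RHS]map_id; apply/eq_in_map => o /Aroots Ao /=.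
  exact: f'K.
Qed.

Lemma isoxx k (g : mgraph k) : iso g g.
Proof. by exists id; exact: is_iso_id. Qed.

Lemma iso_sym k (g g' : mgraph k) : iso g g' -> iso g' g.
Proof. by move=> [f /is_iso_inv[]// f' f'P _]; exists f'. Qed.

Lemma iso_trans k (g g' g'' : mgraph k) : iso g g' -> iso g' g'' -> iso g g''.
Proof. by move=> [f fP] [f' f'P]; exists (f' \o f); exact: is_iso_comp f'P. Qed.

Lemma ball_isoxx k r (g : mgraph k) : ball_iso r g g.
Proof. by exists id; exact: is_iso_id. Qed.

Lemma ball_iso_sym k r (g g' : mgraph k) : ball_iso r g g' -> ball_iso r g' g.
Proof.
move=> [f fP]; have [u|h hP _] := is_iso_inv _ fP; first exact: root_rball.
by exists h.
Qed.

Lemma ball_iso_trans k r (g g' g'' : mgraph k) :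
  ball_iso r g g' -> ball_iso r g' g'' -> ball_iso r g g''.
Proof. by move=> [f fP] [f' f'P]; exists (f' \o f); exact: is_iso_comp f'P. Qed.

Lemma is_iso_rball k (g g' : mgraph k) (A : set g) (A' : set g') f r s :
  (r <= s)%N -> rball g s `<=` A -> is_iso A A' f ->
  forall v, rball g r v -> rball g' r (f v).
Proof.
move=> rs gA [_ af rf] v [u [p [go gp <- pr]]].
exists (f u), (map f p); split.
- by rewrite -rf; apply: map_f.
- have : forall q1 q2, p = q1 ++ q2 ->
      path (@adj g') (f (last u q1)) (map f q2).
    move=> q1 q2; elim: q2 q1 => [//|x q2 ih] q1 e /=.
    have pP q q' : p = q ++ q' -> A (last u q).
      move=> e'; apply: gA; exists u, q; split => //.
        by move: gp; rewrite e' cat_path => /andP[].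
      by rewrite (leq_trans _ (leq_trans pr rs))// e' size_cat leq_addr.
    have e2 : p = rcons q1 x ++ q2 by rewrite cat_rcons.
    apply/andP; split; last by have := ih _ e2; rewrite last_rcons.
    have := pP _ _ e; have := pP _ _ e2; rewrite last_rcons => Ax Al.
    by rewrite af//; move: gp; rewrite e cat_path /= => /and3P[].
  by move=> /(_ [::] p erefl).
- by rewrite last_map.
- by rewrite size_map.
Qed.

Lemma is_iso_rball_iso k (g g' : mgraph k) (A : set g) (A' : set g') f r s :
  (r <= s)%N -> rball g s `<=` A -> rball g' s `<=` A' -> is_iso A A' f ->
  is_iso (rball g r) (rball g' r) f.
Proof.
move=> rs gA gA' fP.
have rA v : rball g r v -> A v.
  move=> [u [p [? ? ? pr]]]; apply: gA; exists u, p; split=> //.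
  exact: leq_trans rs.
have rA' v : rball g' r v -> A' v.
  move=> [u [p [? ? ? pr]]]; apply: gA'; exists u, p; split=> //.
  exact: leq_trans rs.
have [|f' f'P [fK f'K]] := is_iso_inv _ fP.
  by move=> o /root_rball go; exact/rA.
have h := is_iso_rball rs gA fP; have h' := is_iso_rball rs gA' f'P.
case: (fP) => [[f1 f2 f3] af rf]; split => //.
- split; first exact: h.
  + by move=> x y; rewrite !inE => /rA Ax /rA Ay; apply: f2; rewrite inE.
  + by move=> y yr; exists (f' y); [exact: h'|exact/f'K/rA'].
- by move=> u v /rA Au /rA Av; exact: af.
Qed.

Lemma ball_iso_le k (g g' : mgraph k) r s :
  (r <= s)%N -> ball_iso s g g' -> ball_iso r g g'.
Proof. by move=> rs [f fP]; exists f; exact: (is_iso_rball_iso rs _ _ fP). Qed.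

Lemma iso_ball_iso k (g g' : mgraph k) r : iso g g' -> ball_iso r g g'.
Proof. by move=> [f fP]; exists f; exact: (is_iso_rball_iso (leqnn r) _ _ fP). Qed.

Definition isob k (g g' : mgraph k) : bool := `[< iso g g' >].

Lemma isob_equiv k : equiv_class_of (@isob k).
Proof.
split.
- by move=> g; apply/asboolP/isoxx.
- by move=> g g'; apply/asboolP/asboolP => /iso_sym.
- by move=> g g' g'' /asboolP h /asboolP h'; exact/asboolP/(iso_trans h).
Qed.

Canonical isob_equiv_rel k := EquivRelPack (@isob_equiv k).

Local Open Scope quotient_scope.

(* Isomorphism classes. R is the field in which the distance is valued. *)
Definition mclass (R : realType) (k : nat) := {eq_quot (@isob_equiv_rel k)}.

HB.instance Definition _ R k := Choice.on (mclass R k).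

Definition mcls (R : realType) k (g : mgraph k) : mclass R k :=
  \pi_({eq_quot (@isob_equiv_rel k)}) g.

Definition mrep (R : realType) k (x : mclass R k) : mgraph k :=
  repr (x : {eq_quot (@isob_equiv_rel k)}).

Lemma mrepK R k (x : mclass R k) : mcls R (mrep x) = x.
Proof. exact: reprK. Qed.

Lemma mclsP R k (g g' : mgraph k) : mcls R g = mcls R g' <-> iso g g'.
Proof.
split=> [/eqmodP/asboolP//|gg'].
by apply/eqmodP/asboolP.
Qed.

Program Definition graph1 : graph :=
  @Graph (pred1 0%N) (fun _ _ => false) _ _ _ _.
Next Obligation. by []. Qed.
Next Obligation. by []. Qed.
Next Obligation.
move=> [u u0] [v v0]; exists [::]; split => //=; apply: val_inj => /=.
by move: u0 v0 => /eqP -> /eqP ->.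
Qed.
Next Obligation. 
move=> v; rewrite (_ : [set _ | _] = set0)//.
by apply/seteqP; split.
Qed.

Definition vertex1 : graph1 := exist _ 0%N (eqxx 0%N).

HB.instance Definition _ R k :=
  isPointed.Build (mclass R k) (mcls R (MGraph (nseq_tuple k.+1 vertex1))).

Section distance.
Context {R : realType} {k : nat}.
Implicit Types x y z : mclass R k.

(* For k = 1 the balls of radius 0 may be non-isomorphic; the distance is then
   the infimum of the empty set, +oo. *)
Definition gdist x y : \bar R :=
  ereal_inf [set ((2^-1) ^+ r)%:E | r in [set r | ball_iso r (mrep x) (mrep y)]].

Definition mball x (e : R) : set (mclass R k) :=
  [set y | (gdist x y < e%:E)%E].

Lemma mballP x e y : mball x e y <->
  exists2 r, ball_iso r (mrep x) (mrep y) & (2^-1) ^+ r < e.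
Proof.
split=> [/ereal_inf_lt[_ [r rxy <-]]|[r rxy re]].
  by rewrite lte_fin => re; exists r.
rewrite /mball/=; apply: le_lt_trans (_ : ((2^-1) ^+ r)%:E < e%:E)%E => //.
by apply: ereal_inf_lbound; exists r.
Qed.

Lemma mball_center x (e : R) : 0 < e -> mball x e x.
Proof.
move=> e0; apply/mballP.
have : (fun r => (2^-1 : R) ^+ r) @ \oo --> 0.
  by apply: cvg_expr; rewrite ger0_norm ?invr_ge0// invf_lt1// ltr1n.
move=> /cvgrPdist_lt/(_ _ e0)[r _ /(_ r (leqnn _))].
rewrite sub0r normrN ger0_norm ?exprn_ge0 ?invr_ge0// => re.
by exists r => //; exact: ball_isoxx.
Qed.

Lemma mball_sym x y (e : R) : mball x e y -> mball y e x.
Proof. by move=> /mballP[r /ball_iso_sym ? ?]; apply/mballP; exists r. Qed.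

Lemma mball_triangle x y z e1 e2 :
  mball x e1 y -> mball y e2 z -> mball x (e1 + e2) z.
Proof.
move=> /mballP[r rxy re1] /mballP[s syz se2]; apply/mballP.
have h t : 0 <= (2^-1 : R) ^+ t by rewrite exprn_ge0// invr_ge0.
have [rs|/ltnW sr] := leqP r s.
  exists r; first exact: ball_iso_trans (ball_iso_le rs syz).
  by rewrite ltr_wpDr// (le_trans (h s) (ltW se2)).
exists s; first exact: ball_iso_trans (ball_iso_le sr rxy) syz.
by rewrite ltr_wpDl// (le_trans (h r) (ltW re1)).
Qed.

HB.instance Definition _ :=
  hasNbhs.Build (mclass R k) (nbhs_ (entourage_ mball)).

HB.instance Definition _ :=
  @Nbhs_isPseudoMetric.Build R (mclass R k) (entourage_ mball) erefl mball
    mball_center mball_sym mball_triangle erefl.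

End distance.

(* The spaces of rooted and of doubly rooted graphs, with their Borel sets. *)
Definition Gstar (R : realType) :=
  g_sigma_algebraType (@open (mclass R 0)).
Definition Gstar2 (R : realType) :=
  g_sigma_algebraType (@open (mclass R 1)).

HB.instance Definition _ R := Measurable.on (Gstar R).
HB.instance Definition _ R := Measurable.on (Gstar2 R).

Definition cls1 {R : realType} (G : graph) (o : G) : Gstar R :=
  mcls R (@MGraph 0 G [tuple o]).
Definition cls2 {R : realType} (G : graph) (o v : G) : Gstar2 R :=
  mcls R (@MGraph 1 G [tuple o; v]).

Section classes.
Context {R : realType}.
Implicit Types (G : graph) (T : Type).

Definition cgraph (x : Gstar R) : graph := mrep (x : mclass R 0).
Definition croot (x : Gstar R) : cgraph x := thead (roots (mrep (x : mclass R 0))).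

Lemma cls1K (x : Gstar R) : cls1 (croot x) = x.
Proof.
rewrite -[RHS](@mrepK R) /cls1 /croot /cgraph.
case: (mrep (x : mclass R 0)) => G s /=; congr (mcls _ (MGraph _)).
by case: s => -[|v []] // s1; apply: val_inj.
Qed.

Lemma cls1P G (o : G) G' (o' : G') : cls1 o = cls1 o' :> Gstar R ->
  exists f : G -> G', [/\ bijective f, forall u v, adj (f u) (f v) = adj u v &
                         f o = o'].
Proof.
move=> /(@mclsP R)[f [fb fa fo]]; exists f; split.
- by rewrite -setTT_bijective.
- by move=> u v; apply: fa.
- by case: fo.
Qed.

Lemma cls2_iso G G' (f : G -> G') (u v : G) : bijective f ->
  (forall u v, adj (f u) (f v) = adj u v) ->
  cls2 (f u) (f v) = cls2 u v :> Gstar2 R.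
Proof.
move=> fb fa; apply/(@mclsP R)/iso_sym; exists f; split => //.
by rewrite setTT_bijective.
Qed.

(* The function of [G, o] given by F G o; F is to be invariant under rooted
   isomorphisms, so that the choice of a representative does not matter. *)
Definition on_class {T} (F : forall G, G -> T) (x : Gstar R) : T :=
  F (cgraph x) (croot x).

Lemma on_class_cls1 {T} (F : forall G, G -> T) :
  (forall G G' (f : G -> G') (o : G), bijective f ->
    (forall u v, adj (f u) (f v) = adj u v) -> F G' (f o) = F G o) ->
  forall G (o : G), on_class F (cls1 o) = F G o.
Proof.
move=> FP G o; rewrite /on_class.
have [f [fb fa <-]] := cls1P (esym (cls1K (cls1 o))).
exact: FP.
Qed.

Lemma sum_nbrs_iso (T : Gstar2 R -> R) G G' (f : G -> G') (o : G) :
  bijective f -> (forall u v, adj (f u) (f v) = adj u v) ->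
  \sum_(v \in nbrs (f o)) T (cls2 (f o) v) = \sum_(v \in nbrs o) T (cls2 o v).
Proof.
move=> fb fa; rewrite (reindex_fsbig f (nbrs o)).
  by apply: eq_fsbigr => v _; rewrite cls2_iso.
split=> [v|u v _ _|v].
- by rewrite /nbrs/= fa.
- exact/bij_inj.
- case: fb => g gK fK; rewrite /nbrs/= -{1}(fK v) fa => ov.
  by exists (g v).
Qed.

End classes.

Section statements.
Context {R : realType} (mu : probability (Gstar R) R).
Implicit Types (x : Gstar R -> R).

(* "for mu-a.e. [G, o], P G o" *)
Definition ae_rooted (P : forall G : graph, G -> Prop) : Prop :=
  {ae mu, forall p : Gstar R, forall (G : graph) (o : G), cls1 o = p -> P G o}.

Definition unimodular : Prop :=
  forall T : Gstar2 R -> \bar R, measurable_fun [set: Gstar2 R] T ->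
    (forall q, 0 <= T q)%E ->
    (\int[mu]_p on_class (fun G o => \esum_(v in [set: G]) T (cls2 o v)) p =
     \int[mu]_p on_class (fun G o => \esum_(v in [set: G]) T (cls2 v o)) p)%E.

(* For H = R, the gradient of F at a is the derivative of F at a, and the
   gradient of F : R * R -> R consists of the two partial derivatives. *)
Definition gateaux (F : R -> R) (a : R) : Prop :=
  forall v : R, is_derive a v F (derive1 F a * v).

Definition grad1 (F : R -> R -> R) (a b : R) : R := derive1 (F ^~ b) a.
Definition grad2 (F : R -> R -> R) (a b : R) : R := derive1 (F a) b.

Definition gateaux2 (F : R -> R -> R) (a b : R) : Prop :=
  forall v w : R, is_derive (a, b) (v, w) (fun p : R * R => F p.1 p.2)
                    (grad1 F a b * v + grad2 F a b * w).

Record admissible (f : Gstar R -> R -> R) (h psi : Gstar2 R -> R -> R -> R)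
    : Prop := Admissible {
  adm_meas_f :
    measurable_fun [set: Gstar R * R] (fun p => f p.1 p.2);
  adm_meas_h :
    measurable_fun [set: Gstar2 R * R * R] (fun p => h p.1.1 p.1.2 p.2);
  adm_meas_psi :
    measurable_fun [set: Gstar2 R * R * R] (fun p => psi p.1.1 p.1.2 p.2);
  adm_diff_f :
    ae_rooted (fun G o => forall a, gateaux (f (cls1 o)) a);
  adm_diff_h :
    ae_rooted (fun G o => forall v, adj o v ->
      [/\ forall a b, gateaux (h (cls2 o v) ^~ b) a,
          forall a b, gateaux2 (psi (cls2 o v)) a b,
          forall a b, grad1 (psi (cls2 o v)) a b = grad1 (h (cls2 o v)) a b &
          forall a b, grad2 (psi (cls2 o v)) a b = grad1 (h (cls2 v o)) b a]);
  adm_lipschitz :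
    exists Lf Lh : R, [/\ 0 <= Lf, 0 <= Lh,
      ae_rooted (fun G o => forall a a',
        `|derive1 (f (cls1 o)) a - derive1 (f (cls1 o)) a'| <= Lf * `|a - a'|) &
      ae_rooted (fun G o => forall v, adj o v -> forall a a' b b',
        `|grad1 (h (cls2 o v)) a b - grad1 (h (cls2 o v)) a' b'|
          <= Lh * (`|a - a'| + `|b - b'|))];
  adm_integrable :
    exists a : R,
      [/\ mu.-integrable [set: Gstar R] (fun p => `|f p a|%:E),
          mu.-integrable [set: Gstar R] (fun p => (`|derive1 (f p) a| ^+ 2)%:E),
          mu.-integrable [set: Gstar R] (EFin \o on_class
            (fun G o => \sum_(v \in nbrs o) `|psi (cls2 o v) a a|)) &
          mu.-integrable [set: Gstar R] (EFin \o on_class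
            (fun G o => \sum_(v \in nbrs o) `|grad1 (h (cls2 o v)) a a| ^+ 2))]
}.

Definition potential_density (f : Gstar R -> R -> R)
    (psi : Gstar2 R -> R -> R -> R) x : Gstar R -> R :=
  on_class (fun G o => f (cls1 o) (x (cls1 o)) +
    2^-1 * \sum_(v \in nbrs o) psi (cls2 o v) (x (cls1 o)) (x (cls1 v))).

Definition potential (f : Gstar R -> R -> R) (psi : Gstar2 R -> R -> R -> R)
    x : R :=
  \int[mu]_(p in [set: Gstar R]) potential_density f psi x p.

Definition cost (f : Gstar R -> R -> R) (h : Gstar2 R -> R -> R -> R)
    (G : graph) (v : G) (y : G -> R) : R :=
  f (cls1 v) (y v) + \sum_(u \in nbrs v) h (cls2 v u) (y v) (y u).

Definition profile x (G : graph) (v : G) : R := x (cls1 v).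
Arguments profile x {G} v.

(* x \in Lfun mu 2 is a function, not a class of functions modulo mu. *)
Definition actions (K : set R) : set (Gstar R -> R) :=
  [set x | x \in Lfun mu 2%:E /\ ae_rooted (fun G o => K (x (cls1 o)))].

Definition quenched_nash (K : set R) (f : Gstar R -> R -> R)
    (h : Gstar2 R -> R -> R -> R) x : Prop :=
  actions K x /\
  ae_rooted (fun G o => forall a, K a ->
    cost f h o (profile x) <= cost f h o [eta profile x with o |-> a]).

Definition laplacian x (G : graph) (o : G) : R :=
  x (cls1 o) - (deg o)%:R^-1 * \sum_(v \in nbrs o) x (cls1 v).

End statements.

(* Main.v *)
(* The functional Phi, and the integrability of its density, rest on neighbour
   sums nbr_sum g [G, o] = sum_(v ~ o) g [G, v]. The neighbour sum of the
   indicator of an open set is lower semicontinuous, since finitely many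
   neighbours are involved and a ball around o contains balls around them; a
   Dynkin argument and approximation by simple functions make nbr_sum g Borel for
   every Borel g. Mass transport with T [G, o, v] = 1_(o ~ v) g [G, v] turns the
   integral of nbr_sum g into that of deg(o) g [G, o], so nbr_sum x^2 is
   integrable when degrees are bounded and x is in L^2. For the equilibrium, the
   Laplace equation says that eta(o) = deg(o) x(o) - sum_(v ~ o) x(v), and then
   deviating from x(o) to a raises the cost by deg(o) (a - x(o))^2 / 2. *)
Require Import Defs.
From mathcomp Require Import all_boot all_order all_algebra finmap ring lra.
From mathcomp Require Import all_classical all_reals all_analysis.
From mathcomp Require Import measurable_realfun.

Import Order.TTheory GRing.Theory Num.Theory.
Import numFieldNormedType.Exports.

Set Implicit Arguments.
Unset Strict Implicit.
Unset Printing Implicit Defensive.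

Local Open Scope classical_set_scope.
Local Open Scope ring_scope.

(** * Open sets and isomorphic balls *)

Section topology.
Context {R : realType}.

(** Metric balls are governed by the powers of 1/2, so openness becomes a finite-radius condition:
    membership in [U] is decided by some ball around the roots. Every topological argument below
    goes through this form. *)
Lemma open_mclassP k (U : set (mclass R k)) : open U <->
  forall x, U x -> exists r, forall y, ball_iso r (mrep x) (mrep y) -> U y.
Proof.
rewrite openE; split=> [Uo x /Uo|Uo x /Uo[r rU]].
  move=> /nbhs_ballP[e /= e0 eU].
  have /mballP[r _ re] := mball_center x e0.
  by exists r => y xy; apply: eU; apply/mballP; exists r.
apply/nbhs_ballP; exists (2^-1 ^+ r); first by rewrite /= exprn_gt0// invr_gt0.
move=> y /mballP[s sxy]; rewrite ltr_iXn2l ?invr_gt0 ?invf_lt1 ?ltr1n// => rs.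
exact/rU/(ball_iso_le (ltnW rs) sxy).
Qed.

(** An isomorphism of large balls restricts to any smaller balls they contain, even around new roots
    [v] and [f v]. The detour through [mrepK] passes to the chosen representatives. *)
Lemma ball_iso_reroot k (g g' : mgraph k) r s (f : g -> g') (v : g) :
  is_iso (rball g s) (rball g' s) f ->
  rball (@MGraph 0 g [tuple v]) r `<=` rball g s ->
  rball (@MGraph 0 g' [tuple f v]) r `<=` rball g' s ->
  ball_iso r (mrep (R:=R) (@cls1 R _ v)) (mrep (R:=R) (@cls1 R _ (f v))).
Proof.
move=> [fb fa _] vs fvs.
have h1 : ball_iso r (mrep (R:=R) (@cls1 R _ v)) (@MGraph 0 g [tuple v]).
  by apply/iso_ball_iso/(mclsP R)/mrepK.
apply: (ball_iso_trans h1).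
have h2 : ball_iso r (@MGraph 0 g [tuple v]) (@MGraph 0 g' [tuple f v]).
  by exists f; exact: (is_iso_rball_iso (leqnn r) vs fvs).
apply: (ball_iso_trans h2).
by apply/iso_ball_iso/(mclsP R)/esym/mrepK.
Qed.

End topology.

Import HBNNSimple.

(** * Measurability of neighbour sums *)

Section neighbour_sums.
Context {R : realType}.

Definition nbr_sum (g : Gstar R -> R) : Gstar R -> R :=
  on_class (fun G o => \sum_(v \in nbrs o) g (cls1 v)).

Lemma finite_nbrs (G : graph) (o : G) : finite_set (nbrs o).
Proof. exact: adj_locally_finite. Qed.

Lemma nbr_sumE g p :
  nbr_sum g p = \sum_(v <- fset_set (nbrs (croot p))) g (cls1 v).
Proof. by rewrite /nbr_sum/on_class fsbig_finite//; exact: finite_nbrs. Qed.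

(** Prepending the edge from [o] to [v] lengthens a path by one; this is the radius lost when the
    root moves to a neighbour. *)
Lemma rball_nbr (G : graph) (o v : G) r : adj o v ->
  rball (@MGraph 0 G [tuple v]) r `<=` rball (@MGraph 0 G [tuple o]) r.+1.
Proof.
move=> ov w [u [p [/= + vp <- pr]]]; rewrite inE => /eqP uv.
rewrite uv in vp *.
by exists o, (v :: p); split => //=; rewrite ?inE// ov.
Qed.

Lemma mclass0E (p : Gstar R) : mrep (R:=R) p = @MGraph 0 (cgraph p) [tuple croot p].
Proof.
rewrite /croot /cgraph; case: (mrep _) => G s /=; congr MGraph.
by case: s => -[|v []] // s1; apply: val_inj.
Qed.

(** A ball of radius at least 1 contains the root and all its neighbours, hence the radius
    [s.+1]. *)
Lemma is_iso_nbrs (G G' : graph) (o : G) (o' : G') (f : G -> G') s :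
  is_iso (rball (@MGraph 0 G [tuple o]) s.+1) (rball (@MGraph 0 G' [tuple o']) s.+1) f ->
  set_bij (nbrs o) (nbrs o') f.
Proof.
move=> [[f1 f2 f3] fa [foo']].
have nb (H : graph) (u v : H) : nbrs u v -> rball (@MGraph 0 H [tuple u]) s.+1 v.
  by move=> uv; exists u, [:: v]; split => //=; rewrite ?inE// uv.
have ob : rball (@MGraph 0 G [tuple o]) s.+1 o.
  by apply: root_rball; rewrite inE.
split.
- by move=> v ov; rewrite /nbrs/= -foo' fa//; exact: nb.
- by move=> u v; rewrite !inE => /nb ou /nb ov; apply: f2; rewrite inE.
- move=> v' ov'; have [v bv fv] := f3 _ (nb _ _ _ ov').
  by exists v => //; rewrite /nbrs/= -fa// foo' fv.
Qed.

(* Finitely many neighbours lie in U, and one radius witnesses all of them; the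
   same neighbours survive in every graph with the same ball. *)
Lemma nbr_sum_indic_open (U : set (Gstar R)) : @open (mclass R 0) U ->
  measurable_fun setT (nbr_sum \1_U).
Proof.
move=> Uo; apply: (measurability _ (RGenOInfty.measurableE R)).
(* Rays above [t] generate the Borel sets of the line; their preimages are shown to be open. *)
move=> _ [_ [t ->] <-]; rewrite setTI; apply: sub_sigma_algebra.
apply/open_mclassP => p; rewrite /= in_itv/= andbT => tp.
have rP (v : cgraph p) : exists r, U (cls1 v) ->
    forall y, ball_iso r (mrep (R:=R) (@cls1 R _ v)) (mrep (R:=R) y) -> U y.
  (* Outside [U] nothing is required, and the radius 0 is a dummy value. *)
  have [Uv|nUv] := pselect (U (cls1 v)); last by exists 0%N.
  by have /open_mclassP/(_ _ Uv)[r] := Uo; exists r.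
have {rP}[rad radP] := choice rP.
pose s := \max_(v <- fset_set (nbrs (croot p))) rad v.
exists s.+1 => p'; rewrite !mclass0E => -[f fP].
have fb := is_iso_nbrs fP.
rewrite /= in_itv/= andbT; apply: lt_le_trans tp _.
rewrite /nbr_sum /on_class (reindex_fsbig f _ _ _ fb).
rewrite !fsbig_finite; try exact: finite_nbrs.
rewrite big_seq_cond [leRHS]big_seq_cond; apply: ler_sum => v; rewrite andbT.
rewrite in_fset_set; last exact: finite_nbrs.
rewrite inE => ov.
rewrite !indicE; case: (boolP (cls1 v \in U)) => //; rewrite inE => Uv.
rewrite mem_set//; apply: (radP _ Uv).
apply: (ball_iso_le (_ : rad v <= s)%N).
  by apply: leq_bigmax_seq => //; rewrite in_fset_set ?inE//; exact: finite_nbrs.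
apply: (@ball_iso_reroot R _ _ _ _ _ _
  (v : @MGraph 0 (cgraph p) [tuple croot p]) fP); first exact: rball_nbr.
apply: rball_nbr; case: fb => fb1 _ _; exact: fb1.
Qed.

(** Dynkin's theorem applies since open sets are stable under intersection. A complement is handled
    by subtraction from the degree, the neighbour sum of 1; a disjoint union by a pointwise
    limit. *)
Lemma nbr_sum_indic A : @measurable _ (Gstar R) A ->
  measurable_fun setT (nbr_sum \1_A).
Proof.
have mT : measurable_fun setT (nbr_sum \1_[set: Gstar R]).
  by apply: nbr_sum_indic_open; exact: openT.
move: A; apply: (@dynkin_induction _ (Gstar R) (@open (mclass R 0))
  (fun A => measurable_fun setT (nbr_sum \1_A))) => //.
- exact: openI.
- exact: nbr_sum_indic_open.
- move=> S _ mS.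
  rewrite (_ : nbr_sum _ = nbr_sum \1_[set: Gstar R] \- nbr_sum \1_S).
    exact: measurable_funB.
  apply/funext => p /=; rewrite !nbr_sumE -sumrB; apply: eq_bigr => v _.
  by rewrite indicT indicC indicE /cst/=; case: (_ \in _); rewrite /= ?subr0 ?subrr.
- move=> F mF tF mnF.
  apply: (@measurable_fun_cvg _ (Gstar R) R setT
    (fun n p => \sum_(i < n) nbr_sum \1_(F i) p)).
    by move=> n; apply: measurable_sum.
  move=> p _; under eq_cvg do (under eq_bigr do rewrite nbr_sumE; rewrite exchange_big/=).
  rewrite nbr_sumE; apply: cvg_big => [|v _].
    exact: add_continuous.
  (* Countable additivity of indicators over disjoint sets is a nonnegative series in the extended
     reals; its finite limit is then brought back to [R]. *)
  pose e n : \bar R := (\sum_(0 <= i < n) (\1_(F i) (cls1 v : Gstar R))%:E)%E.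
  have : e n @[n --> \oo] --> (\1_(\bigcup_k F k) (cls1 v : Gstar R))%:E.
    by rewrite indic_bigcup//; apply: is_cvg_nneseries => n _ _; rewrite lee_fin.
  move=> /fine_cvgP[_]; apply: cvg_trans; apply: near_eq_cvg; near=> n.
  by rewrite /e /= sumEFin /= big_mkord.
Unshelve. all: by end_near. Qed.

Lemma measurable_nbr_sum (g : Gstar R -> R) : measurable_fun setT g ->
  measurable_fun setT (nbr_sum g).
Proof.
wlog g0 : g / forall p, 0 <= g p => [hw mg|mg].
  rewrite (_ : nbr_sum g = nbr_sum g^\+ \- nbr_sum g^\-).
    apply: measurable_funB; apply: hw => //.
    - exact: measurable_funrpos.
    - exact: measurable_funrneg.
  apply/funext => p /=; rewrite !nbr_sumE -sumrB; apply: eq_bigr => v _.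
  by rewrite -[in LHS](funrposBneg g).
have mEg : measurable_fun setT (EFin \o g) by exact/measurable_EFinP.
have [|h [_ hg]] := approximation measurableT mEg.
  by move=> p _; exact: g0.
have {}hg (y : Gstar R) : h n y @[n --> \oo] --> g y by have /fine_cvgP[] := hg y I.
apply: (@measurable_fun_cvg _ (Gstar R) R setT (fun n => nbr_sum (h n))) => [n|p _].
  (* A simple function is a finite combination of indicators of its level sets, and neighbour sums
     are linear. *)
  rewrite (_ : nbr_sum _ = fun p => \sum_(y <- fset_set (range (h n)))
      y * nbr_sum \1_(h n @^-1` [set y]) p).
    apply: measurable_sum => y; apply: measurable_funM => //.
    exact: nbr_sum_indic.
  apply/funext => p; rewrite nbr_sumE.
  under [RHS]eq_bigr do rewrite nbr_sumE mulr_sumr.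
  rewrite exchange_big/=; apply: eq_bigr => v _.
  by rewrite fimfunE fsbig_finite.
under eq_cvg do rewrite nbr_sumE.
rewrite nbr_sumE; apply: cvg_big => [|v _]; first exact: add_continuous.
exact: hg.
Qed.

End neighbour_sums.

(** * Mass transport along edges *)

Section mass_transport.
Context {R : realType}.

Definition root2 (i : 'I_2) (q : Gstar2 R) : mrep (R:=R) q :=
  tnth (Defs.roots (mrep (R:=R) q)) i.

Definition edges : set (Gstar2 R) := [set q | adj (root2 ord0 q) (root2 ord_max q)].

Definition endpoint (q : Gstar2 R) : Gstar R := cls1 (root2 ord_max q).

Lemma is_iso_tnth_roots k (g g' : mgraph k) A A' (f : g -> g') i :
  is_iso A A' f -> f (tnth (Defs.roots g) i) = tnth (Defs.roots g') i.
Proof.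
move=> [_ _ fr]; rewrite -(tnth_map f).
have <- : map_tuple f (Defs.roots g) = Defs.roots g' by exact: val_inj.
by [].
Qed.

Lemma edges_cls2 (G : graph) (u v : G) : edges (cls2 u v) = adj u v.
Proof.
have [f fP] : iso (@MGraph 1 G [tuple u; v]) (mrep (R:=R) (@cls2 R G u v)).
  by apply/(mclsP R); rewrite mrepK.
rewrite /edges /root2 /= -!(is_iso_tnth_roots _ fP); case: fP => _ -> //.
Qed.

Lemma endpoint_cls2 (G : graph) (u v : G) : endpoint (cls2 u v) = cls1 v.
Proof.
have [f fP] : iso (@MGraph 1 G [tuple u; v]) (mrep (R:=R) (@cls2 R G u v)).
  by apply/(mclsP R); rewrite mrepK.
apply/(mclsP R)/iso_sym; exists f; case: (fP) => fb fa _; split => //=.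
by rewrite /root2 -(is_iso_tnth_roots _ fP).
Qed.

(** Radius 0 suffices: that ball already contains both roots, and an isomorphism of induced
    subgraphs preserves their adjacency. *)
Lemma measurable_edges : measurable edges.
Proof.
apply: sub_sigma_algebra; apply/open_mclassP => q eq; exists 0%N => q' [f fP].
rewrite /edges /root2 /= -!(is_iso_tnth_roots _ fP); case: fP => _ -> //.
- by apply: root_rball; exact: mem_tnth.
- by apply: root_rball; exact: mem_tnth.
Qed.

(** The ball around the second root lies in the ball of the same radius around both roots, so the
    map is continuous without loss of radius. *)
Lemma measurable_endpoint : measurable_fun setT endpoint.
Proof.
have rb (q : mgraph 1) r :
    rball (@MGraph 0 q [tuple tnth (Defs.roots q) ord_max]) r `<=` rball q r.
  move=> w [u [p [/= + vp <- pr]]]; rewrite inE => /eqP uv.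
  by exists u, p; split => //; rewrite uv mem_tnth.
apply: (@measurability _ _ (Gstar2 R) (Gstar R) setT endpoint (@open (mclass R 0))) => //.
move=> _ [U Uo <-].
rewrite setTI; apply: sub_sigma_algebra; apply/open_mclassP => q Uq.
have /open_mclassP/(_ _ Uq)[r rU] := Uo; exists r => q' [f fP].
apply: rU; rewrite /endpoint /root2 -(is_iso_tnth_roots _ fP).
apply: (ball_iso_reroot fP) => //.
by rewrite (is_iso_tnth_roots _ fP).
Qed.

(** The Boolean [b] lets one lemma serve outgoing mass, weighted by [adj o v], and incoming mass,
    weighted by [adj v o]. *)
Lemma esum_nbrs (G : graph) (o : G) (b : G -> bool) (g : G -> R) :
  (forall v, b v = adj o v) -> (forall v, 0 <= g v) ->
  (\esum_(v in [set: G]) ((b v)%:R * g v)%:E)%E = (\sum_(v \in nbrs o) g v)%:E.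
Proof.
move=> bE g0; rewrite -fsumEFin; last exact: finite_nbrs.
rewrite -esum_fset; last 2 first.
- exact: finite_nbrs.
- by move=> v _; rewrite lee_fin.
rewrite [RHS]esum_mkcond; apply: eq_esum => v _.
rewrite bE; case: (boolP (adj o v)) => ov.
  by rewrite mem_set ?mul1r.
by rewrite memNset ?mul0r//; exact/negP.
Qed.

Lemma unimodular_nbr_sum (mu : probability (Gstar R) R) (g : Gstar R -> R) :
  unimodular mu -> measurable_fun setT g -> (forall p, 0 <= g p) ->
  (\int[mu]_p (nbr_sum g p)%:E = \int[mu]_p (nbr_sum (cst 1%R) p * g p)%:E)%E.
Proof.
move=> mu_unimod mg g0.
pose T q := (\1_edges q * g (endpoint q))%:E.
have TE (G : graph) (u v : G) : T (cls2 u v) = ((adj u v)%:R * g (cls1 v))%:E.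
  rewrite /T indicE endpoint_cls2; congr (_%:R * _)%:E; congr nat_of_bool.
  by apply/idP/idP; rewrite inE edges_cls2.
have := mu_unimod T; rewrite /on_class => h.
transitivity (\int[mu]_p \esum_(v in [set: cgraph p]) T (cls2 (croot p) v))%E.
  apply: eq_integral => p _; under eq_esum do rewrite TE.
  by rewrite (@esum_nbrs _ (croot p)).
rewrite h//.
(* Incoming mass: each neighbour sends the same amount [g p] to the root. *)
- apply: eq_integral => p _; under eq_esum do rewrite TE.
  rewrite (@esum_nbrs _ (croot p)) => [|v|v]; last exact: g0.
    rewrite cls1K /nbr_sum /on_class mulr_fsuml; congr (_%:E).
    by apply: eq_fsbigr => v _; rewrite mul1r.
  exact: adj_sym.
- apply/measurable_EFinP/measurable_funM.
    apply: measurable_indic; exact: measurable_edges.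
  apply: measurableT_comp => //; exact: measurable_endpoint.
- by move=> q; rewrite lee_fin mulr_ge0.
Qed.

End mass_transport.

(** * Integrability under bounded degree *)

Section ae_rooted.
Context {R : realType} (mu : probability (Gstar R) R).

Lemma ae_rootedT (P : forall G : graph, G -> Prop) :
  (forall (G : graph) (o : G), P G o) -> ae_rooted mu P.
Proof. by move=> h; apply: aeW => p G o _. Qed.

Lemma ae_rooted_croot (P : forall G : graph, G -> Prop) :
  ae_rooted mu P -> {ae mu, forall p, P (cgraph p) (croot p)}.
Proof. by apply: filterS => p h; apply: h; exact: cls1K. Qed.

(** Writing the degree as a neighbour sum makes it measurable by [measurable_nbr_sum]. *)
Lemma nbr_sum1 (p : Gstar R) : nbr_sum (cst 1) p = (deg (croot p))%:R.
Proof. by rewrite nbr_sumE big_const_seq count_predT iter_addr_0 /deg. Qed.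

Lemma integrable_deg_mul (D : nat) (g : Gstar R -> R) :
  ae_rooted mu (fun G o => forall v : G, (deg v <= D)%N) ->
  (forall p, 0 <= g p) ->
  mu.-integrable setT (EFin \o g) ->
  mu.-integrable setT (fun p => (nbr_sum (cst 1) p * g p)%:E).
Proof.
move=> /ae_rooted_croot deg_le g0 gint.
have mg : measurable_fun setT g by move/integrableP : gint => [/measurable_EFinP].
have mdg : measurable_fun setT (fun p => nbr_sum (cst (1 : R)) p * g p).
  by apply: measurable_funM => //; apply: measurable_nbr_sum.
have n0 p : 0 <= nbr_sum (cst (1 : R)) p by rewrite nbr_sum1.
apply/integrableP; split; first exact/measurable_EFinP.
(* Almost everywhere the product is dominated by [D%:R * g p]. *)
have /integrableP[_] := integrableZl measurableT D%:R gint.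
apply: le_lt_trans; apply: ae_ge0_le_integral => //.
- by apply: measurableT_comp => //; exact/measurable_EFinP.
- by apply: measurableT_comp => //; apply/measurable_EFinP/measurable_funM.
apply: filterS deg_le => p deg_le _ /=.
by rewrite lee_fin !normrM ler_wpM2r// nbr_sum1 !normr_nat ler_nat.
Qed.

Lemma integrable_nbr_sum (D : nat) (g : Gstar R -> R) :
  unimodular mu ->
  ae_rooted mu (fun G o => forall v : G, (deg v <= D)%N) ->
  (forall p, 0 <= g p) ->
  mu.-integrable setT (EFin \o g) ->
  mu.-integrable setT (EFin \o nbr_sum g).
Proof.
move=> mu_unimod deg_le g0 gint.
have mg : measurable_fun setT g by move/integrableP : gint => [/measurable_EFinP].
have ng0 p : 0 <= nbr_sum g p by rewrite nbr_sumE sumr_ge0.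
have n0 p : 0 <= nbr_sum (cst (1 : R)) p by rewrite nbr_sum1.
apply/integrableP; split.
  by apply/measurable_EFinP; exact: measurable_nbr_sum.
(* Mass transport equates this finite integral with that of [nbr_sum g]; nonnegativity removes the
   absolute values. *)
have /integrableP[_] := integrable_deg_mul deg_le g0 gint.
under [X in (X < _)%E -> _]eq_integral do rewrite gee0_abs ?lee_fin ?mulr_ge0//.
rewrite -unimodular_nbr_sum//.
by under [X in _ -> (X < _)%E]eq_integral do rewrite gee0_abs ?lee_fin//.
Qed.

End ae_rooted.

(** * The density of the potential *)

Section density.
Context {R : realType} (mu : probability (Gstar R) R).

Definition edge_density (eta x : Gstar R -> R) : Gstar R -> R :=
  on_class (fun G o => - eta (cls1 o) * x (cls1 o) +
    4^-1 * \sum_(v \in nbrs o) (x (cls1 o) - x (cls1 v)) ^+ 2).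

(** Expanding the squares leaves only products of measurable functions and neighbour sums. *)
Lemma edge_densityE eta x p : edge_density eta x p =
  - eta p * x p + 4^-1 * (nbr_sum (cst 1) p * x p ^+ 2 -
    2 * x p * nbr_sum x p + nbr_sum (fun q => x q ^+ 2) p).
Proof.
rewrite /edge_density /on_class cls1K fsbig_finite; last exact: finite_nbrs.
congr (_ + _ * _); rewrite !nbr_sumE mulr_suml mulr_sumr -sumrB -big_split/=.
by apply: eq_bigr => v _; rewrite sqrrB mul1r -mulr_natl mulrA.
Qed.

Lemma edge_density_le eta x p : `|edge_density eta x p| <=
  eta p ^+ 2 + x p ^+ 2 + nbr_sum (cst 1) p * x p ^+ 2 + nbr_sum (fun q => x q ^+ 2) p.
Proof.
rewrite /edge_density /on_class cls1K fsbig_finite; last exact: finite_nbrs.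
rewrite !nbr_sumE mulr_suml -!addrA -big_split/= addrA.
apply: le_trans (ler_normD _ _) _; apply: lerD.
  (* The two squares bound the product by half the sum of squares, in absolute value. *)
  have := sqr_ge0 (eta p - x p); have := sqr_ge0 (eta p + x p).
  by rewrite ler_norml; move=> *; apply/andP; split; nra.
rewrite mulr_sumr ger0_norm ?sumr_ge0// => [|v _]; last first.
  by rewrite mulr_ge0 ?invr_ge0// sqr_ge0.
(* Termwise, $(a-b)^2 \le 2(a^2+b^2)$ because $(a+b)^2 \ge 0$. *)
apply: ler_sum => v _; have := sqr_ge0 (x p + x (cls1 v)).
have := sqr_ge0 (x p); have := sqr_ge0 (x (cls1 v)) => ? ? ?.
have -> : 4^-1 = 2^-1 * 2^-1 :> R by field.
nra.
Qed.

Lemma integrable_edge_density (D : nat) eta x :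
  unimodular mu ->
  ae_rooted mu (fun G o => forall v : G, (deg v <= D)%N) ->
  eta \in Lfun mu 2%:E -> x \in Lfun mu 2%:E ->
  mu.-integrable setT (EFin \o edge_density eta x).
Proof.
move=> mu_unimod deg_le eta2 x2.
have meta : measurable_fun setT eta.
  by move: eta2; rewrite inE => /andP[]; rewrite inE.
have mx : measurable_fun setT x.
  by move: x2; rewrite inE => /andP[]; rewrite inE.
have ieta := Lfun2_integrable_sqr eta2; have ix := Lfun2_integrable_sqr x2.
have x20 p : 0 <= x p ^+ 2 by exact: sqr_ge0.
(* The dominating function is the bound of [edge_density_le]. *)
have := integrableD measurableT (integrableD measurableT (integrableD measurableT ieta ix)
  (integrable_deg_mul deg_le x20 ix)) (integrable_nbr_sum mu_unimod deg_le x20 ix).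
apply: le_integrable => // [|p _].
  rewrite (_ : edge_density eta x = fun p => - eta p * x p +
    4^-1 * (nbr_sum (cst 1) p * x p ^+ 2 - 2 * x p * nbr_sum x p +
    nbr_sum (fun q => x q ^+ 2) p)); last exact/funext/edge_densityE.
  have mx2 : measurable_fun setT (fun q => x q ^+ 2) by exact: measurable_funX.
  apply/measurable_EFinP/measurable_funD.
    by apply: measurable_funM => //; exact: measurableT_comp.
  apply: measurable_funM => //; apply: measurable_funD.
    apply: measurable_funB; apply: measurable_funM => //.
    - by apply: measurable_nbr_sum.
    - exact: measurable_funM.
    - exact: measurable_nbr_sum.
  exact: measurable_nbr_sum.
rewrite /= lee_fin; apply: le_trans (edge_density_le _ _ _) _.
exact: ler_norm.
Qed.

End density.

(** * Derivatives and convexity of the quadratic cost *)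

Section quadratic.
Context {R : realType}.

(** The difference quotient equals [d] for every nonzero [h]. A general [V] covers both [R] and
    [R * R]. *)
Lemma is_derive_affine (V : normedModType R) (L : V -> R) (a v : V) (d : R) :
  (forall h : R, L (h *: v + a) = L a + h * d) -> is_derive a v L d.
Proof.
move=> LE; have Lcvg : (fun h => h^-1 *: ((L \o shift a) (h *: v) - L a)) @ 0^' --> d.
  apply: cvg_near_cst; near=> h.
  have h0 : h != 0 by near: h; exact: nbhs_dnbhs_neq.
  by rewrite /= LE addrC addKr /GRing.scale/= mulKf.
apply: DeriveDef; first by apply/cvg_ex; exists d.
exact: cvg_lim Lcvg.
Unshelve. all: by end_near. Qed.

Lemma is_derive_half_sqr (V : normedModType R) (L : V -> R) (a v : V) (d : R) :
  is_derive a v L d -> is_derive a v (fun x => 2^-1 * L x ^+ 2) (L a * d).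
Proof.
move=> dL; have := is_deriveZ 2^-1 (is_deriveX 2 dL).
move=> h; apply: (is_derive_eq h).
by rewrite /GRing.scale/= expr1; field.
Qed.

Lemma is_derive_half_sqr_sub (a b v : R) :
  is_derive a v (fun a => 2^-1 * (a - b) ^+ 2) ((a - b) * v).
Proof.
apply: (is_derive_half_sqr (L := fun a => a - b)); apply: is_derive_affine => h.
by rewrite /GRing.scale/=; ring.
Qed.

Lemma derive1_half_sqr_sub (a b : R) :
  derive1 (fun a => 2^-1 * (a - b) ^+ 2) a = a - b.
Proof.
rewrite derive1E; have h := is_derive_half_sqr_sub a b 1.
by rewrite derive_val mulr1.
Qed.

Lemma derive1_half_sqr_subC (a b : R) :
  derive1 (fun b => 2^-1 * (a - b) ^+ 2) b = b - a.
Proof.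
have -> : (fun b => 2^-1 * (a - b) ^+ 2) = (fun b => 2^-1 * (b - a) ^+ 2) :> (R -> R).
  by apply/funext => c; rewrite -sqrrN opprB.
exact: derive1_half_sqr_sub.
Qed.

Lemma gateaux_half_sqr_sub (a b : R) :
  gateaux (fun a => 2^-1 * (a - b) ^+ 2) a.
Proof. by move=> v; rewrite derive1_half_sqr_sub; exact: is_derive_half_sqr_sub. Qed.

Lemma gateaux2_half_sqr_sub (a b : R) :
  gateaux2 (fun a b => 2^-1 * (a - b) ^+ 2) a b.
Proof.
move=> v w; rewrite /grad1 /grad2 derive1_half_sqr_sub derive1_half_sqr_subC.
rewrite (_ : _ + _ = (a - b) * (v - w)); last by ring.
apply: (is_derive_half_sqr (L := fun p : R * R => p.1 - p.2)).
by apply: is_derive_affine => h /=; rewrite /GRing.scale/=; ring.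
Qed.

Lemma is_derive_mul (c a v : R) : is_derive a v (fun a => c * a) (c * v).
Proof.
by apply: is_derive_affine => h; rewrite /GRing.scale/=; ring.
Qed.

Lemma derive1_mul (c a : R) : derive1 (fun a => c * a) a = c.
Proof.
by rewrite derive1E; have h := is_derive_mul c a 1; rewrite derive_val mulr1.
Qed.

Lemma half_sqr_sub_conv (s x y b : R) : 0 <= s -> s <= 1 ->
  2^-1 * (s * x + (1 - s) * y - b) ^+ 2 <=
  s * (2^-1 * (x - b) ^+ 2) + (1 - s) * (2^-1 * (y - b) ^+ 2).
Proof.
move=> s0 s1; rewrite -subr_ge0.
(* The convexity gap is explicit and independent of [b]. *)
rewrite [X in _ <= X](_ : _ = 2^-1 * (s * (1 - s) * (x - y) ^+ 2)); last by ring.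
apply: mulr_ge0; first by rewrite invr_ge0.
by apply: mulr_ge0 (sqr_ge0 _); apply: mulr_ge0 => //; rewrite subr_ge0.
Qed.

Lemma convex_cost (G : graph) (o : G) (c : R) (b : G -> R) :
  @convex_function R R^o [set: R]
    (fun a => c * a + \sum_(v \in nbrs o) 2^-1 * (a - b v) ^+ 2).
Proof.
move=> t x y _ _; rewrite !convRE.
have fin : finite_set (nbrs o) by exact: finite_nbrs.
have s0 : 0 <= t%:inum by [].
have s1 : t%:inum <= 1 by [].
rewrite !(fsbig_finite _ _ fin).
set s := t%:inum in s0 s1 *.
rewrite (_ : mathcomp.classical.unstable.onem s = 1 - s)//.
have -> : c * (s * x + (1 - s) * y) = s * (c * x) + (1 - s) * (c * y) by ring.
rewrite (mulrDr s) (mulrDr (1 - s)) addrACA; apply: lerD => //.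
rewrite !mulr_sumr -big_split /=; apply: ler_sum => v _.
exact: half_sqr_sub_conv.
Qed.

End quadratic.

(** * Optimality of the root action *)

Section equilibrium.
Context {R : realType}.

Lemma cost_root_le (eta x : Gstar R -> R) (G : graph) (o : G) (a : R) :
  (0 < deg o)%N -> laplacian x o = eta (cls1 o) / (deg o)%:R ->
  cost (fun p a => - eta p * a) (fun _ a b => 2^-1 * (a - b) ^+ 2) o (profile x (G:=G)) <=
  cost (fun p a => - eta p * a) (fun _ a b => 2^-1 * (a - b) ^+ 2) o
    [eta profile x (G:=G) with o |-> a].
Proof.
move=> deg0 lap.
have d0 : (deg o)%:R != 0 :> R by rewrite pnatr_eq0 -lt0n.
have etaE : eta (cls1 o) = (deg o)%:R * x (cls1 o) - \sum_(v \in nbrs o) x (cls1 v).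
  have := congr1 ( *%R (deg o)%:R) lap; rewrite /laplacian mulrBr.
  by rewrite mulVKf// [RHS]mulrCA divff// mulr1.
rewrite /cost /= eqxx -subr_ge0.
(* Without loops, a deviation at [o] leaves the neighbours' actions unchanged. *)
have -> : \sum_(u \in nbrs o) 2^-1 * (a - (if u == o then a else profile x u)) ^+ 2
  = \sum_(u \in nbrs o) 2^-1 * (a - x (cls1 u)) ^+ 2.
  apply: eq_fsbigr => u; rewrite inE /nbrs /= => ou.
  by case: eqP => // uo; rewrite uo adj_irr in ou.
rewrite /profile etaE !fsbig_finite; try exact: finite_nbrs.
set s := fset_set _; set y := x _.
have degE c : (deg o)%:R * c = \sum_(u <- s) c :> R.
  by rewrite big_const_seq count_predT iter_addr_0 mulr_natl.
have sumE c : \sum_(u <- s) 2^-1 * (c - x (cls1 u)) ^+ 2 =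
    2^-1 * ((deg o)%:R * c ^+ 2) - c * (\sum_(u <- s) x (cls1 u)) +
    2^-1 * \sum_(u <- s) x (cls1 u) ^+ 2.
  rewrite degE !mulr_sumr -sumrB -big_split /=.
  by apply: eq_bigr => u _; field.
(* After substitution of [etaE] the neighbour sums cancel and a square is completed. *)
rewrite [X in 0 <= X](_ : _ = (deg o)%:R * (2^-1 * (a - y) ^+ 2)).
  by rewrite mulr_ge0// mulr_ge0 ?sqr_ge0// invr_ge0.
by rewrite !sumE; field.
Qed.

End equilibrium.

(** * Admissibility, convexity, potential and equilibrium *)

Theorem proposition4p1 (R : realType) (mu : probability (Gstar R) R)
    (D : nat) (eta : Gstar R -> R)
    (mu_unimodular : unimodular mu)
    (deg_gt0 : ae_rooted mu (fun G o => (0 < deg o)%N))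
    (deg_le : ae_rooted mu (fun G o => forall v : G, (deg v <= D)%N))
    (eta_L2 : eta \in Lfun mu 2%:E) :
  let f : Gstar R -> R -> R := fun x a => - eta x * a in
  let h : Gstar2 R -> R -> R -> R := fun _ a b => 2^-1 * (a - b) ^+ 2 in
  let psi := h in
  [/\ admissible mu f h psi,
      ae_rooted mu (fun G o => forall b : G -> R,
        @convex_function R R^o [set: R]
          (fun a => f (cls1 o) a + \sum_(v \in nbrs o) h (cls2 o v) a (b v))),
      forall x : Gstar R -> R, x \in Lfun mu 2%:E ->
        mu.-integrable [set: Gstar R] (EFin \o potential_density f psi x) /\
        potential mu f psi x =
          \int[mu]_(p in [set: Gstar R])
            on_class (fun G o => - eta (cls1 o) * x (cls1 o) +
              4^-1 * \sum_(v \in nbrs o) (x (cls1 o) - x (cls1 v)) ^+ 2) p &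
      forall x : Gstar R -> R, x \in Lfun mu 2%:E ->
        ae_rooted mu (fun G o => laplacian x o = eta (cls1 o) / (deg o)%:R) ->
        quenched_nash mu [set: R] f h x].
Proof.
move=> f h psi.
have meta : measurable_fun setT eta.
  by move: eta_L2; rewrite inE => /andP[]; rewrite inE.
have mh : measurable_fun [set: Gstar2 R * R * R] (fun p => h p.1.1 p.1.2 p.2).
  apply: measurable_funM => //; apply: measurable_funX.
  apply: measurable_funB => //; exact: measurableT_comp.
have densityE x : potential_density f psi x = edge_density eta x.
  apply/funext => p; rewrite /potential_density /edge_density /on_class.
  rewrite -mulr_fsumr mulrA; congr (_ + _ * _).
  by rewrite -invfM -natrM.
split.
- constructor => //.
  + apply: measurable_funM => //; apply: measurableT_comp => //.
    exact: measurableT_comp.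
  + apply: ae_rootedT => G o a v; rewrite /f derive1_mul; exact: is_derive_mul.
  + apply: ae_rootedT => G o v ov; split => a b.
    * exact: gateaux_half_sqr_sub.
    * exact: gateaux2_half_sqr_sub.
    * by [].
    * by rewrite /grad1 /grad2 derive1_half_sqr_subC derive1_half_sqr_sub.
  (* The derivative of [f] is constant in [a], and that of [h] is [a - b]. *)
  + exists 0, 1; split => //.
      by apply: ae_rootedT => G o a a'; rewrite /f !derive1_mul subrr normr0 mul0r.
    apply: ae_rootedT => G o v ov a a' b b'.
    rewrite /grad1 !derive1_half_sqr_sub mul1r.
    by rewrite (_ : _ - _ = (a - a') - (b - b')) ?ler_normB//; ring.
  (* At the reference action 0 everything vanishes except the derivative of [f], whose square is
     [eta] squared. *)
  + exists 0; split.
    * apply: (@eq_integrable _ _ _ mu _ measurableT (cst 0%E)); last exact: integrable0.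
      move=> p _.
      by rewrite /f mulr0 normr0.
    * apply: (@eq_integrable _ _ _ mu _ measurableT _ _ _ (Lfun2_integrable_sqr eta_L2)) => p _.
      by rewrite /f derive1_mul normrN real_normK// num_real.
    * apply: (@eq_integrable _ _ _ mu _ measurableT (cst 0%E)); last exact: integrable0.
      move=> p _.
      rewrite /= /on_class fsbig1// => v _.
      by rewrite /psi /h subrr expr0n mulr0 normr0.
    * apply: (@eq_integrable _ _ _ mu _ measurableT (cst 0%E)); last exact: integrable0.
      move=> p _.
      rewrite /= /on_class fsbig1// => v _.
      by rewrite /grad1 derive1_half_sqr_sub subrr normr0 expr0n.
- by apply: ae_rootedT => G o b; exact: convex_cost.
- move=> x x2; split; first by rewrite densityE; exact: integrable_edge_density deg_le _ _.
  by rewrite /potential densityE.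
- move=> x x2 lap; split; first by split => //; exact: ae_rootedT.
  apply: filterS2 deg_gt0 lap => p deg_gt0 lap G o op a _.
  by apply: cost_root_le; [exact: deg_gt0|exact: lap].
Qed.
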